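(* Let $F\in\mathcal{F}^*$ and suppose in addition that for all $\delta>0$ there is $x_\delta\in(0,1]$ with $$F_\theta'(x)\ge(1-\delta)\cdot F_\theta'(0)\qquad\text{for all }x\in[0,x_\delta]\text{ and all }\theta\in\mathbb{T}^D.$$ Then there is $\gamma_+>0$ such that for all $N\in\mathbb{N}$ $$\mu_{\phi^+}\bigl(\{(\theta,x)\in\mathbb{T}^D\times[0,1]:\lambda_N(\theta,x)\ge0\}\bigr)\ge e^{-\gamma_+N}.$$
   Context: $\mathbb{T}^D=\mathbb{R}^D/\mathbb{Z}^D$ ($D\ge1$), with metric $\operatorname{dist}$ induced by the Euclidean metric; $\mathbb{N}=\{1,2,\dots\}$. The class $\mathcal{F}$: maps $F:\mathbb{T}^D\times[0,1]\to\mathbb{T}^D\times[0,1]$, $F(\theta,x)=(\theta+\rho,F_\theta(x))$, where $\rho\in\mathbb{T}^D$ is a rotation vector such that $\theta\mapsto\theta+\rho$ is minimal, satisfying: (i) each fibre map $F_\theta:[0,1]\to[0,1]$ is non-decreasing; (ii) each $F_\theta$ is differentiable and $(\theta,x)\mapsto F_\theta'(x)$ is continuous on $\mathbb{T}^D\times[0,1]$; (iii) $F$ is pinched: there is $\theta_*\in\mathbb{T}^D$ with $F_{\theta_*}(x)=0$ for all $x\in[0,1]$; (iv) $F_\theta(0)=0$ for all $\theta\in\mathbb{T}^D$. The class $\mathcal{F}^*$: those $F\in\mathcal{F}$ for which there exist constants $\alpha>2$, $\beta>0$, $\gamma>0$, $L_0\in(0,1)$, $c>0$, $d>1$, $m\in\mathbb{N}$,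 $a>1$, $0<b<1$ such that, with $\tau_n=\theta_*+n\rho$, for all $\theta,\theta'\in\mathbb{T}^D$: 1. $|F_\theta(x)-F_\theta(y)|\le\alpha|x-y|$ for all $x,y\in[0,1]$; 2. $|F_\theta(x)-F_\theta(y)|\le\alpha^{-\gamma}|x-y|$ for all $x,y\in[L_0,1]$; 3. $|F_\theta(x)-F_{\theta'}(x)|\le\beta\operatorname{dist}(\theta,\theta')$ for all $x\in[0,1]$; 4. $\operatorname{dist}(\tau_n,\theta_* )\ge c\cdot n^{-d}$ for all $n\in\mathbb{N}$; 5. $m>22(1+\frac1\gamma)$; 6. $a\ge(m+1)^d$; 7. $b\le c$; 8. $\operatorname{dist}(\tau_n,\theta_* )>b$ for all $n\in\{1,\dots,m-1\}$; 9. $F_\theta(x)\ge\min\{2L_0,ax\}\cdot\min\{1,\frac2b\operatorname{dist}(\theta,\theta_* )\}$ for all $x\in[0,1]$. Write $F^N_\theta(x)$ for the second coordinate of $F^N(\theta,x)$. The time-$N$ Lyapunov exponent is $\lambda_N(\theta,x)=\frac1N\log\bigl((F^N_\theta)'(x)\bigr)$ (with $\log0=-\infty$). The upper boundary graph of the global attractor is $\phi^+(\theta)=\sup\{x\in[0,1]:(\theta,x)\in\bigcap_{n\in\mathbb{N}}F^n(\mathbb{T}^D\times[0,1])\}$, and $\mu_{\phi^+}$ is the measure $\mu_{\phi^+}(A)=\operatorname{Leb}_{\mathbb{T}^D}(\{\theta\in\mathbb{T}^D:(\theta,\phi^+(\theta))\in A\})$ for measurable $A\subseteq\mathbb{T}^D\times[0,1]$.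 *)

(* Defs.v *)
From HB Require Import structures.
From mathcomp Require Import all_boot all_order all_algebra.
From mathcomp Require Import all_classical all_reals all_analysis.
From mathcomp Require Import measurable_realfun.
Set Implicit Arguments.
Unset Strict Implicit.
Unset Printing Implicit Defensive.
Import Order.TTheory GRing.Theory Num.Theory.
Import numFieldNormedType.Exports.
Local Open Scope classical_set_scope.
Local Open Scope ring_scope.

Section Torus.
Variables (R : realType) (D : nat).

Definition int_lattice : {pred 'rV[R]_D} :=
  fun u => [forall i, u ord0 i \is a Num.int].

Fact int_lattice_zmod_closed : zmod_closed int_lattice.
Proof.
split=> [|u v]; first by apply/forallP => i; rewrite mxE rpred0.
by move=> /forallP uZ /forallP vZ; apply/forallP => i; rewrite !mxE rpredB.
Qed.
HB.instance Definition _ :=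
  GRing.isZmodClosed.Build 'rV[R]_D int_lattice int_lattice_zmod_closed.

(* R^D / Z^D, with the quotient topology, the quotient group law and the
   Borel sigma-algebra. *)
Definition torus : Type := quotient_topology (Quotient.quot int_lattice).
HB.instance Definition _ := PointedTopological.on torus.
HB.instance Definition _ :=
  GRing.Zmodule.copy torus (Quotient.quot int_lattice).
HB.instance Definition _ :=
  Measurable.copy torus (g_sigma_algebraType (@open torus)).

Definition torus_proj (u : 'rV[R]_D) : torus :=
  (\pi_(quotient_topology (Quotient.quot int_lattice)) u)%qT.

Lemma torus_projD u v : torus_proj (u + v) = torus_proj u + torus_proj v.
Proof. exact: (raddfD (\pi_(Quotient.quot int_lattice))%qT). Qed.

Lemma torus_proj_eq u v : torus_proj u = torus_proj v <->
  exists k : 'I_D -> int, forall i, u ord0 i = v ord0 i + (k i)%:~R.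
Proof.
have -> : (torus_proj u = torus_proj v) <-> u - v \in int_lattice.
  rewrite Quotient.idealrBE; split => [uv|/eqP//]; exact/eqP.
split=> [/forallP h|[k h]].
  have /choice[k hk] : forall i, exists m : int, u ord0 i - v ord0 i = m%:~R.
    by move=> i; have /intrP := h i; rewrite !mxE.
  by exists k => i; rewrite -hk addrC subrK.
by apply/forallP => i; rewrite !mxE h addrC addKr; apply/intrP; exists (k i).
Qed.

Definition euclidean_norm (u : 'rV[R]_D) : R :=
  Num.sqrt (\sum_i u ord0 i ^+ 2).

Definition torus_dist (x y : torus) : R :=
  inf [set r | exists u v, [/\ torus_proj u = x, torus_proj v = y &
                               r = euclidean_norm (u - v)]].

End Torus.

Section TorusMeasure.
Variable R : realType.

Definition tuple_cons n (p : measurableTypeR R * n.-tuple (measurableTypeR R)) : n.+1.-tuple (measurableTypeR R) :=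
  [tuple of p.1 :: p.2].

Fact measurable_tuple_cons n : measurable_fun setT (@tuple_cons n).
Proof. by apply: measurable_cons. Qed.
HB.instance Definition _ n := isMeasurableFun.Build _ _ _ _ (@tuple_cons n)
  (@measurable_tuple_cons n).

(* Lebesgue measure on the unit cube: uniform_prob ltr01 is Lebesgue measure
   restricted to [0, 1]. *)
Fixpoint cube_measure n : probability (n.-tuple (measurableTypeR R)) R :=
  if n is m.+1
  then distribution (uniform_prob (@ltr01 R) \x cube_measure m)%E (@tuple_cons m)
  else \d_([tuple] : 0.-tuple (measurableTypeR R)).

Variable D : nat.

Definition torus_of_tuple (t : D.-tuple (measurableTypeR R)) : torus R D :=
  torus_proj (\row_i tnth t i).

Fact measurable_torus_of_tuple : measurable_fun setT torus_of_tuple.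
Proof.
apply: (@measurability _ _ _ _ _ _ (@open (torus R D))) => //.
move=> _ [V oV <-]; rewrite setTI.
pose f (t : D.-tuple (measurableTypeR R)) : 'rV[R]_D := \row_i tnth t i.
pose V' : set 'rV[R]_D := @torus_proj R D @^-1` V.
have {}oV : open V' by exact: oV.
rewrite -[X in measurable X]/(f @^-1` V').
pose box (p : D.-tuple rat * nat) : set (D.-tuple (measurableTypeR R)) :=
  \bigcap_(i in [set: 'I_D])
    ((@tnth D (measurableTypeR R) ^~ i) @^-1` ball (ratr (tnth p.1 i) : R) p.2.+1%:R^-1).
have mbox p : measurable (box p).
  apply: fin_bigcap_measurable => // i _.
  rewrite -[X in measurable X]setTI.
  by apply: measurable_tnth => //; exact: measurable_ball.
rewrite (_ : _ @^-1` _ = \bigcup_p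
    (if `[< box p `<=` f @^-1` V' >] then box p else set0)).
  by apply: countable_bigcupT_measurable => [|p]; [exact: countableP|case: ifP].
apply/seteqP; split => [t Vt|t [p _]]; last by case: asboolP => // + ?; apply.
have /nbhs_ballP[e /= e0 eV] : nbhs (f t) V' by exact: open_nbhs_nbhs.
have [k ke] : exists k, k.+1%:R^-1 < e / 2.
  have e20 : 0 < e / 2 by rewrite divr_gt0.
  by have [k] := ltr_add_invr e20; rewrite add0r; exists k.
have k0 : 0 < k.+1%:R^-1 :> R by rewrite invr_gt0.
have /choice[q qP] i :
    exists q : rat, ball (tnth t i : R) k.+1%:R^-1 (ratr q : R).
  have [||x [bx [q _ qx]]] := @dense_rat R (ball (tnth t i : R) k.+1%:R^-1).
  - by exists (tnth t i : R); exact: ballxx.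
  - exact: ball_open.
  - by exists q; rewrite qx.
pose p := ([tuple q i | i < D], k).
have pt : box p t.
  by move=> i _ /=; rewrite tnth_mktuple; apply: ball_sym; exact: qP.
exists p => //; case: asboolP => // nb; exfalso; apply: nb => s ps.
apply: eV; split => // i j; rewrite !mxE (splitr e).
apply: (@ball_triangle R R (ratr (q j))).
  by apply: le_ball (qP j); exact: ltW.
by have := ps j I; rewrite /= tnth_mktuple => /le_ball; apply; exact: ltW.
Qed.
HB.instance Definition _ := isMeasurableFun.Build _ _ _ _ torus_of_tuple
  measurable_torus_of_tuple.

Definition torus_lebesgue : probability (torus R D) R :=
  distribution (cube_measure D) torus_of_tuple.

End TorusMeasure.

Section UnitIntervalDerivative.
Variables (R : realType) (f : R -> R).

(* Differentiability of a function on [0, 1]: the difference quotient only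
   ranges over [0, 1], so that it is one-sided at the endpoints. *)
Definition diff_quotient (x y : R) : R := (f y - f x) / (y - x).

Definition derivable01 (x : R) : Prop :=
  cvg (diff_quotient x @ within `[0, 1] x^').

Definition derive01 (x : R) : R := lim (diff_quotient x @ within `[0, 1] x^').

End UnitIntervalDerivative.

Definition minimal_map (T : topologicalType) (f : T -> T) : Prop :=
  forall x, dense (range (fun n => iter n f x)).

Section SkewProducts.
Variables (R : realType) (D : nat).
Local Notation T := (torus R D).

(* A self-map of T^D x [0, 1] is encoded by a function on T^D x R whose values
   outside this strip are irrelevant. *)
Implicit Type F : T * R -> T * R.

Definition strip : set (T * R) := [set: T] `*` `[0, 1].

Definition fibre F (theta : T) (x : R) : R := (F (theta, x)).2.

Record in_classF_with F (rho thetas : T) : Prop := InClassF {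
  maps_strip : forall theta x, x \in `[0, 1] -> fibre F theta x \in `[0, 1];
  skew_rotation :
    forall theta x, x \in `[0, 1] -> (F (theta, x)).1 = theta + rho;
  rotation_minimal : minimal_map (fun theta : T => theta + rho);
  fibre_nondecreasing :
    forall theta, {in `[0, 1] &, {homo fibre F theta : x y / x <= y}};
  fibre_derivable :
    forall theta x, x \in `[0, 1] -> derivable01 (fibre F theta) x;
  fibre_derive_continuous :
    {within strip, continuous (fun p => derive01 (fibre F p.1) p.2)};
  pinched : forall x, x \in `[0, 1] -> fibre F thetas x = 0;
  zero_invariant : forall theta, fibre F theta 0 = 0 }.

Definition in_classF F : Prop := exists rho thetas, in_classF_with F rho thetas.

(* tau_n is thetas + rho *+ n. *)
Record Fstar_conditions F (rho thetas : T)
    (alpha beta gamma L0 c d : R) (m : nat) (a b : R) : Prop := FstarConditions {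
  Fstar_alpha : 2 < alpha;
  Fstar_beta : 0 < beta;
  Fstar_gamma : 0 < gamma;
  Fstar_L0 : 0 < L0 < 1;
  Fstar_c : 0 < c;
  Fstar_d : 1 < d;
  Fstar_m : (0 < m)%N;
  Fstar_a : 1 < a;
  Fstar_b : 0 < b < 1;
  Fstar1 : forall theta, {in `[0, 1] &, forall x y,
    `|fibre F theta x - fibre F theta y| <= alpha * `|x - y|};
  Fstar2 : forall theta, {in `[L0, 1] &, forall x y,
    `|fibre F theta x - fibre F theta y| <= alpha `^ (- gamma) * `|x - y|};
  Fstar3 : forall theta theta', {in `[0, 1], forall x,
    `|fibre F theta x - fibre F theta' x| <= beta * torus_dist theta theta'};
  Fstar4 : forall n, (0 < n)%N ->
    c * n%:R `^ (- d) <= torus_dist (thetas + rho *+ n) thetas;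
  Fstar5 : 22 * (1 + 1 / gamma) < m%:R;
  Fstar6 : m.+1%:R `^ d <= a;
  Fstar7 : b <= c;
  Fstar8 : forall n, (0 < n < m)%N -> b < torus_dist (thetas + rho *+ n) thetas;
  Fstar9 : forall theta, {in `[0, 1], forall x,
    Num.min (2 * L0) (a * x) * Num.min 1 (2 / b * torus_dist theta thetas)
      <= fibre F theta x} }.

Definition in_classFstar F : Prop :=
  exists rho thetas, in_classF_with F rho thetas /\
    exists alpha beta gamma L0 c d m a b,
      Fstar_conditions F rho thetas alpha beta gamma L0 c d m a b.

Definition fibre_iter F N : T -> R -> R := fibre (iter N F).

(* lne 0 = -oo *)
Definition lyapunov F N (theta : T) (x : R) : \bar R :=
  ((N%:R^-1)%:E * lne (derive01 (fibre_iter F N theta) x)%:E)%E.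

Definition global_attractor F : set (T * R) :=
  \bigcap_(n in [set n | (0 < n)%N]) (iter n F @` strip).

Definition phi_plus F (theta : T) : R :=
  sup [set x | x \in `[0, 1] /\ global_attractor F (theta, x)].

Definition mu_phi_plus F (A : set (T * R)) : \bar R :=
  torus_lebesgue R D [set theta | A (theta, phi_plus F theta)].

End SkewProducts.

(* Main.v *)
Require Import Defs.
From mathcomp Require Import all_boot all_order all_algebra.
From mathcomp Require Import all_classical all_reals all_analysis.
From mathcomp Require Import ring lra zify.
Unset Printing Implicit Defensive.
Import Order.TTheory GRing.Theory Num.Theory.
Import numFieldNormedType.Exports.
Local Open Scope classical_set_scope.
Local Open Scope ring_scope.

(* On the ball of radius r around thetas + rho the attractor lies below
   beta * r, because thetas is pinched.  If r = exp(- kappa N) with kappa large,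
   the N-step orbit of (theta, phi_plus theta) stays below x_(1/2), so each
   factor of the derivative of the N-th iterate is at least half of the one at
   x = 0, which by condition (9) is at least a * min(1, 2/b dist).  By the
   Diophantine condition the orbit of thetas is within b/2 * 2^(- i d) of thetas
   at most N / 2^i times, so the product of the min(1, 2/b dist) is at least
   4^(- d N), and a >= 24^d outweighs it.  The ball contains a cube of measure
   exp(- kappa D N). *)

(** * Measure of boxes in the unit cube *)

Section CubeMeasure.
Set Implicit Arguments.
Context {R : realType}.

(* No measurability is assumed: the integral of a nonnegative function is a
   supremum over the simple functions below it. *)
Lemma ge0_le_integralT {d} {T : measurableType d}
    (mu : {measure set T -> \bar R}) (f g : T -> \bar R) :
  (forall x, (0 <= f x)%E) -> (forall x, (f x <= g x)%E) ->
  (\int[mu]_x f x <= \int[mu]_x g x)%E.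
Proof.
move=> f0 fg; have g0 x : (0 <= g x)%E by exact: le_trans (fg x).
rewrite !ge0_integralTE//; apply: le_ereal_sup => _ [h hf <-].
by exists h => // x; exact: le_trans (fg x).
Qed.

(** The sets are arbitrary because the set of base points in the theorem is never shown to be
    measurable. The cube measure is an iterated integral over sections down to a Dirac mass, and
    each layer is monotone on all sets. *)
Lemma le_cube_measure n (A B : set (n.-tuple (measurableTypeR R))) :
  A `<=` B -> (cube_measure R n A <= cube_measure R n B)%E.
Proof.
elim: n A B => [|n IHn] A B AB /=.
  rewrite /dirac !indicE lee_fin ler_nat.
  by case: (boolP (_ \in A)) => // /set_mem/AB/mem_set ->.
rewrite /distribution /pushforward /product_measure1.
apply: ge0_le_integralT => x /=; first by [].
by apply: IHn => t; rewrite /xsection /= => /set_mem/AB/mem_set.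
Qed.

(** The corner is indexed by [nat] so that dropping the first coordinate is the shift [l \o succn],
    without casts between ordinals. *)
Definition tuple_box n (l : nat -> R) (s : R) :
    set (n.-tuple (measurableTypeR R)) :=
  [set t | forall i : 'I_n, l i <= tnth t i <= l i + s].
Arguments tuple_box : clear implicits.

Lemma tuple_box_consE n (l : nat -> R) (s : R) :
  @tuple_cons R n @^-1` tuple_box n.+1 l s =
  `[l 0%N, l 0%N + s]%classic `*` tuple_box n (l \o succn) s.
Proof.
apply/seteqP; split => -[x t] /=.
  move=> h; split; first by have := h ord0; rewrite /= tnth0 in_itv.
  by move=> i; have := h (lift ord0 i); rewrite tnthS /= /bump/= add1n.
move=> [x0 ht] i; case: (unliftP ord0 i) => [j|] ->.
  by rewrite tnthS; have := ht j; rewrite /= /bump/= add1n.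
by rewrite /= tnth0; rewrite in_itv in x0.
Qed.

Lemma measurable_tuple_box n (l : nat -> R) (s : R) :
  measurable (tuple_box n l s).
Proof.
rewrite (_ : tuple_box n l s = \bigcap_(i in [set: 'I_n])
    ((@tnth n (measurableTypeR R) ^~ i) @^-1` `[l i, l i + s])); last first.
  apply/seteqP; split => t /= h i => [_|]; first by rewrite /= in_itv /= h.
  by have := h i I; rewrite /= in_itv.
apply: fin_bigcap_measurable => // i _.
rewrite -[X in measurable X]setTI.
by apply: measurable_tnth => //; exact: measurable_itv.
Qed.

Lemma uniform01_itv (x y : R) : 0 <= x -> x <= y -> y <= 1 ->
  uniform_prob (@ltr01 R) `[x, y] = (y - x)%:E.
Proof.
move=> x0 xy y1; rewrite /uniform_prob.
rewrite (eq_integral (fun=> 1%E)); last first.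
  move=> z; rewrite inE /= in_itv /= => /andP[xz zy].
  by rewrite /uniform_pdf (le_trans x0 xz) (le_trans zy y1) subr0 invr1.
rewrite integral_cst//= mul1e lebesgue_measure_itv /= lte_fin.
case: ltP => // yx; have -> : y = x by apply/eqP; rewrite eq_le xy yx.
by rewrite subrr.
Qed.

Lemma cube_measure_box n (l : nat -> R) (s : R) : 0 <= s ->
    (forall i, 0 <= l i) -> (forall i, l i + s <= 1) ->
  cube_measure R n (tuple_box n l s) = (s ^+ n)%:E.
Proof.
move=> s0; elim: n l => [|n IHn] l l0 l1 /=.
  by rewrite expr0 /dirac indicE mem_set// => -[].
rewrite /distribution /pushforward tuple_box_consE product_measure1E//; last first.
  exact: measurable_tuple_box.
rewrite exprS EFinM; congr mule; last by apply: IHn => i /=.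
rewrite [LHS]uniform01_itv//; last by rewrite lerDl.
by rewrite addrAC subrr add0r.
Qed.

End CubeMeasure.

(** * Euclidean norm and the quotient metric on the torus *)

Section TorusMetric.
Set Implicit Arguments.
Context {R : realType} {D : nat}.
Implicit Types (p q u v : 'rV[R]_D) (x y z : torus R D).

Lemma sum_sqr_ge0 p : 0 <= \sum_i p ord0 i ^+ 2.
Proof. by apply: sumr_ge0 => i _; exact: sqr_ge0. Qed.

Lemma cauchy_schwarz p q :
  (\sum_i p ord0 i * q ord0 i) ^+ 2 <=
  (\sum_i p ord0 i ^+ 2) * (\sum_i q ord0 i ^+ 2).
Proof.
have lagrange : \sum_i \sum_j (p ord0 i * q ord0 j - p ord0 j * q ord0 i) ^+ 2
    = 2 * ((\sum_i p ord0 i ^+ 2) * (\sum_i q ord0 i ^+ 2)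
           - (\sum_i p ord0 i * q ord0 i) ^+ 2).
  have dbl (a b : 'I_D -> R) :
      (\sum_i a i) * (\sum_j b j) = \sum_i \sum_j a i * b j.
    exact: big_distrlr.
  rewrite mulrBr mulr_natl mulr2n {2}mulrC expr2 !dbl mulr_sumr -sumrN.
  rewrite -!big_split; apply: eq_bigr => i _ /=.
  rewrite mulr_sumr -sumrN -!big_split; apply: eq_bigr => j _ /=; ring.
rewrite -subr_ge0 -(pmulr_rge0 _ (@ltr0Sn R 1)) -lagrange.
by apply: sumr_ge0 => i _; apply: sumr_ge0 => j _; exact: sqr_ge0.
Qed.

Lemma euclidean_norm_ge0 u : 0 <= euclidean_norm u.
Proof. exact: sqrtr_ge0. Qed.

Lemma euclidean_norm0 : euclidean_norm (0 : 'rV[R]_D) = 0.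
Proof.
by rewrite /euclidean_norm big1 ?sqrtr0// => i _; rewrite mxE expr0n.
Qed.

Lemma euclidean_normN u : euclidean_norm (- u) = euclidean_norm u.
Proof.
by congr Num.sqrt; apply: eq_bigr => i _; rewrite mxE sqrrN.
Qed.

Lemma ler_euclidean_normD p q :
  euclidean_norm (p + q) <= euclidean_norm p + euclidean_norm q.
Proof.
have pq0 : 0 <= euclidean_norm p + euclidean_norm q.
  by rewrite addr_ge0 ?euclidean_norm_ge0.
rewrite -[leRHS]ger0_norm// -sqrtr_sqr ler_wsqrtr// sqrrD.
rewrite !sqr_sqrtr ?sum_sqr_ge0//.
have : \sum_i p ord0 i * q ord0 i <= euclidean_norm p * euclidean_norm q.
  rewrite (le_trans (ler_norm _))// -sqrtr_sqr -sqrtrM ?sum_sqr_ge0//.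
  by rewrite ler_wsqrtr// cauchy_schwarz.
rewrite (_ : \sum_i _ ^+ 2 = \sum_i p ord0 i ^+ 2
    + (\sum_i p ord0 i * q ord0 i) *+ 2 + \sum_i q ord0 i ^+ 2); last first.
  rewrite -sumrMnl -!big_split; apply: eq_bigr => i _.
  by rewrite mxE sqrrD.
rewrite /euclidean_norm; lra.
Qed.

(** A crude [D] replaces its square root; this only affects the constant in the final rate. *)
Lemma ler_euclidean_norm_coord u (s : R) : 0 <= s ->
  (forall i, `|u ord0 i| <= s) -> euclidean_norm u <= D%:R * s.
Proof.
move=> s0 us; have Ds0 : 0 <= D%:R * s by rewrite mulr_ge0.
rewrite -[leRHS]ger0_norm// -sqrtr_sqr ler_wsqrtr//.
apply: (@le_trans _ _ (\sum_(i < D) s ^+ 2)).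
  by apply: ler_sum => i _; rewrite -real_normK ?num_real// lerXn2r ?nnegrE.
rewrite sumr_const card_ord exprMn -[leLHS]mulr_natl ler_wpM2r ?sqr_ge0//.
by rewrite -natrX ler_nat; case: (D) => // n; rewrite leq_pmulr.
Qed.

Lemma torus_proj_surj x : exists u, torus_proj u = x.
Proof.
exists (repr (x : Quotient.quot (int_lattice (R:=R) (D:=D)))).
exact: reprK.
Qed.

Let dists x y := [set r | exists u v, [/\ torus_proj u = x, torus_proj v = y &
                               r = euclidean_norm (u - v)]].

Let has_inf_dists x y : has_inf (dists x y).
Proof.
split; last by exists 0 => _ [u [v [_ _ ->]]]; exact: euclidean_norm_ge0.
have [[u ux] [v vy]] := (torus_proj_surj x, torus_proj_surj y).
by exists (euclidean_norm (u - v)), u, v.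
Qed.

Lemma torus_dist_ge0 x y : 0 <= torus_dist x y.
Proof.
apply: lb_le_inf; first by have [] := has_inf_dists x y.
by move=> _ [u [v [_ _ ->]]]; exact: euclidean_norm_ge0.
Qed.

Lemma torus_dist_le u v :
  torus_dist (torus_proj u) (torus_proj v) <= euclidean_norm (u - v).
Proof.
apply: ge_inf; last by exists u, v.
by have [] := has_inf_dists (torus_proj u) (torus_proj v).
Qed.

Lemma torus_distxx x : torus_dist x x = 0.
Proof.
apply/eqP; rewrite eq_le torus_dist_ge0 andbT.
have [u <-] := torus_proj_surj x.
by rewrite (le_trans (torus_dist_le _ _))// subrr euclidean_norm0.
Qed.

Lemma torus_distC x y : torus_dist x y = torus_dist y x.
Proof.
rewrite /torus_dist; congr inf; apply/seteqP; split=> r [u [v [ux vy ->]]];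
  by exists v, u; split => //; rewrite -euclidean_normN opprB.
Qed.

Lemma torus_dist_triangle y x z :
  torus_dist x z <= torus_dist x y + torus_dist y z.
Proof.
rewrite -lerBlDr; apply: lb_le_inf; first by have [] := has_inf_dists x y.
move=> _ [u [v [<- <- ->]]]; rewrite lerBlDl -lerBlDr.
apply: lb_le_inf; first by have [] := has_inf_dists (torus_proj v) z.
move=> _ [u' [v' [u'v <- ->]]]; rewrite lerBlDr.
(* The two infima choose their lifts of the middle point independently. Translating the second pair
   by the lattice vector [v - u'] makes these lifts agree. *)
have -> : torus_proj v' = torus_proj (v' + v - u').
  rewrite -addrA torus_projD.
  have -> : torus_proj (v - u') = 0 :> torus R D.
    by apply: (addIr (torus_proj u')); rewrite -torus_projD subrK add0r u'v.
  by rewrite addr0.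
rewrite (le_trans (torus_dist_le _ _))//.
rewrite (_ : u - _ = (u' - v') + (u - v)) ?ler_euclidean_normD//.
by rewrite !opprD opprK; apply/rowP => i; rewrite !mxE; ring.
Qed.

Lemma torus_distDr z x y : torus_dist (x + z) (y + z) = torus_dist x y.
Proof.
suff le x' y' z' : torus_dist (x' + z') (y' + z') <= torus_dist x' y'.
  apply/eqP; rewrite eq_le le/=.
  by rewrite -{1}(addrK z x) -{1}(addrK z y) le.
apply: lb_le_inf; first by have [] := has_inf_dists x' y'.
have [w <-] := torus_proj_surj z'.
move=> _ [u [v [<- <- ->]]]; rewrite -!torus_projD.
rewrite (le_trans (torus_dist_le _ _))//.
by rewrite opprD addrACA subrr addr0.
Qed.

End TorusMetric.

(** * Products of truncated factors, bounded by counting visits at dyadic scales *)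

Section DyadicProduct.
Set Implicit Arguments.

(** Time 0 is treated as a visit, so even the first visit costs [L] and no additive 1 appears. If
    [n.+1] is a visit, it is the only one among the last [L] times, and that block is removed. *)
Lemma count_separated (P : pred nat) (L n : nat) :
  (0 < L)%N ->
  (forall i j, (i < j)%N -> (i == 0%N) || P i -> P j -> (L <= j - i)%N) ->
  ((\sum_(1 <= j < n.+1) P j) * L <= n)%N.
Proof.
move=> L0 sep; elim/ltn_ind: n => n IH.
case: n IH => [|n] IH; first by rewrite big_geq.
rewrite big_nat_recr//=; case: (boolP (P n.+1)) => [Pn|_]; last first.
  by rewrite addn0 (leq_trans (IH n _)).
have Ln : (L <= n.+1)%N by have := sep 0%N n.+1 isT isT Pn; rewrite subn0.
have -> : (\sum_(1 <= j < n.+1) P j = \sum_(1 <= j < (n.+1 - L).+1) P j)%N.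
  rewrite (@big_cat_nat _ _ _ (n.+1 - L).+1)//=; last by rewrite ltn_subrL L0.
  rewrite [X in (_ + X)%N]big_nat_cond [X in (_ + X)%N]big1 ?addn0// => j.
  rewrite andbT => /andP[nj jn]; apply/eqP; rewrite eqb0; apply/negP => Pj.
  have := sep j n.+1 jn _ Pn; rewrite Pj orbT => /(_ isT).
  by rewrite leqNgt ltn_subLR ?(leq_trans _ jn)// => /negP; apply; lia.
have := IH (n.+1 - L)%N; rewrite ltn_subrL L0 => /(_ isT); lia.
Qed.

Context {R : realType}.

(** The levels [i] with [f < q ^- i] form an initial segment, so their number is the first level
    that [f] reaches, or [M]. *)
Lemma min1_dyadic (q f : R) (M : nat) : 1 <= q -> q ^- M <= f ->
  q ^- (\sum_(i < M) (f < q ^- i)%R)%N <= Num.min 1 f.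
Proof.
move=> q1; have q0 : 0 < q by exact: lt_le_trans q1.
elim: M => [|M IH] qf.
  by rewrite big_ord0; rewrite expr0 invr1 in qf *; rewrite le_min lexx.
rewrite big_ord_recr /=; case: (ltP f (q ^- M)) => [fq|/IH]; last first.
  by rewrite addn0.
rewrite (eq_bigr (fun=> 1%N)) => [|i _]; last first.
  rewrite (lt_le_trans fq)// lef_pV2 ?posrE ?exprn_gt0//.
  by rewrite ler_weXn2l// ltnW.
rewrite sum1_card card_ord addn1 le_min qf andbT.
by rewrite invf_le1 ?exprn_gt0// exprn_ege1.
Qed.

(** Exchanging the sums over times and levels, the exponent becomes a sum of visit counts, at most
    the geometric series of the [N / 2 ^ i]. *)
Lemma prod_min1_dyadic (q : R) (f : nat -> R) (N : nat) : 1 <= q ->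
  (forall i, (\sum_(1 <= j < N.+1) (f j < q ^- i)%R) * 2 ^ i <= N)%N ->
  q ^- (2 * N) <= \prod_(1 <= j < N.+1) Num.min 1 (f j).
Proof.
move=> q1 cnt; have q0 : 0 < q by exact: lt_le_trans q1.
pose e j := (\sum_(i < N) (f j < q ^- i)%R)%N.
(* At level [N] a single visit would already give [2 ^ N <= N], so only levels below [N] occur. *)
have qf j : (0 < j < N.+1)%N -> q ^- N <= f j.
  move=> jN; rewrite leNgt; apply/negP => fj.
  have := cnt N; rewrite (bigD1_seq j) ?iota_uniq ?mem_index_iota//= fj.
  by rewrite mulnDl mul1n => /(leq_trans (leq_addr _ _)); rewrite leqNgt ltn_expl.
apply: (@le_trans _ _ (\prod_(1 <= j < N.+1) q ^- e j)); last first.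
  rewrite big_nat [leRHS]big_nat; apply: ler_prod => j jN.
  rewrite invr_ge0 exprn_ge0 ?(ltW q0)//=.
  exact/min1_dyadic/qf.
have -> : \prod_(1 <= j < N.+1) q ^- e j = q ^- (\sum_(1 <= j < N.+1) e j).
  by elim/big_rec2: _ => [|j x n _ ->]; rewrite ?expr0 ?invr1// exprD invfM.
rewrite lef_pV2 ?posrE ?exprn_gt0// ler_weXn2l// exchange_big/=.
(* Partial sums are at most [2 * N * (1 - 2 ^- M)], with denominators cleared; the extra [2 * N]
   makes the induction close. *)
suff main M : ((\sum_(i < M) \sum_(1 <= j < N.+1) (f j < q ^- i)%R) * 2 ^ M + 2 * N
    <= 2 * N * 2 ^ M)%N.
  rewrite -(@leq_pmul2r (2 ^ N)) ?expn_gt0//.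
  exact: leq_trans (leq_addr _ _) (main N).
elim: M => [|M IH]; first by rewrite big_ord0 !muln1.
rewrite big_ord_recr/= expnS; have := cnt M; move: IH.
set a := bigop _ _ _; set c := bigop _ _ _; set t := expn _ _; nia.
Qed.

End DyadicProduct.

(** * Differentiation on the closed unit interval *)

Section UnitIntervalDerivative.
Set Implicit Arguments.
Context {R : realType}.
Implicit Types (f g : R -> R) (x y l : R).

(** This division-free form composes in the chain rule even where the inner increment vanishes. *)
Definition has_derive01 f x l := forall e, 0 < e -> exists2 d, 0 < d &
  forall y, y \in `[0, 1] -> `|y - x| < d ->
    `|f y - f x - l * (y - x)| <= e * `|y - x|.

Let approach x : set_system R := within `[0, 1] x^'.

(** Needed for uniqueness of the limit. Moving from [x] towards the farther endpoint by at most one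
    half stays inside the interval. *)
Let approach_proper x : x \in `[0, 1] -> ProperFilter (approach x).
Proof.
move=> x01; split; last exact: within_filter.
rewrite /approach /within /= => /nbhs_ballP[e /= e0 xe].
rewrite in_itv /= in x01.
have [x2|x2] := leP x 2^-1.
  pose y := x + Num.min (e / 2) 2^-1.
  have m0 : 0 < Num.min (e / 2) 2^-1 by rewrite lt_min; apply/andP; split; lra.
  have m1 : Num.min (e / 2) 2^-1 <= e / 2 by rewrite ge_min lexx.
  have m2 : Num.min (e / 2) 2^-1 <= 2^-1 by rewrite ge_min lexx orbT.
  apply: (xe y) => /=; rewrite /y; [|apply/eqP; lra|rewrite in_itv /=; lra].
  by rewrite /ball /= opprD addNKr normrN ger0_norm; lra.
pose y := x - Num.min (e / 2) 2^-1.
have m0 : 0 < Num.min (e / 2) 2^-1 by rewrite lt_min; apply/andP; split; lra.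
have m1 : Num.min (e / 2) 2^-1 <= e / 2 by rewrite ge_min lexx.
have m2 : Num.min (e / 2) 2^-1 <= 2^-1 by rewrite ge_min lexx orbT.
apply: (xe y) => /=; rewrite /y; [|apply/eqP; lra|rewrite in_itv /=; lra].
by rewrite /ball /= opprB addrC subrK ger0_norm; lra.
Qed.

Lemma derivable01P f x : x \in `[0, 1] -> derivable01 f x ->
  has_derive01 f x (derive01 f x).
Proof.
move=> x01 df e e0; have := df.
rewrite /derivable01 => /cvgrPdist_le/(_ e e0).
rewrite /= {1}/within /= => /nbhs_ballP[d /= d0 xd]; exists d => // y y01 yx.
have [->|yneq] := eqVneq y x; first by rewrite !subrr mulr0 subr0 normr0 mulr0.
have yx0 : y - x != 0 by rewrite subr_eq0.
have := xd y; rewrite /ball /= distrC => /(_ yx yneq y01).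
rewrite -/(derive01 f x) => dq.
rewrite [X in `|X|](_ : _ = - (derive01 f x - diff_quotient f x y) * (y - x)).
  by rewrite normrM normrN ler_wpM2r.
by rewrite /diff_quotient; field.
Qed.

Lemma derive01_eq f x l : x \in `[0, 1] -> has_derive01 f x l ->
  derive01 f x = l.
Proof.
move=> x01 df; have px := @approach_proper x x01.
apply: cvg_lim => //; apply/cvgrPdist_le => e e0.
have [d d0 xd] := df e e0.
rewrite /= {1}/within /=; apply/nbhs_ballP; exists d => // y.
rewrite /ball /= distrC => yx yneq y01.
have yx0 : y - x != 0 by rewrite subr_eq0.
rewrite -(ler_pM2r (_ : 0 < `|y - x|)) ?normr_gt0// (le_trans _ (xd y y01 yx))//.
rewrite -normrM -normrN [X in `|X|](_ : _ = f y - f x - l * (y - x))//.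
by rewrite /diff_quotient; field.
Qed.

Lemma has_derive01_id x : has_derive01 id x 1.
Proof.
move=> e e0; exists 1 => // y _ _.
by rewrite mul1r subrr normr0 mulr_ge0// ltW.
Qed.

Lemma has_derive01_eq f g x l : x \in `[0, 1] -> {in `[0, 1], f =1 g} ->
  has_derive01 g x l -> has_derive01 f x l.
Proof.
move=> x01 fg dg e e0; have [d d0 xd] := dg e e0.
by exists d => // y y01 yx; rewrite !fg// xd.
Qed.

Lemma has_derive01_comp f g x l l' : x \in `[0, 1] ->
  {in `[0, 1], forall y, g y \in `[0, 1]} ->
  has_derive01 g x l -> has_derive01 f (g x) l' ->
  has_derive01 (f \o g) x (l' * l).
Proof.
move=> x01 g01 dg df e e0.
(* With the error of [g] capped at 1, [C] is a Lipschitz constant of [g] at [x]; [K] is a positive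
   bound for the outer derivative. *)
pose C := `|l| + 1; pose K := `|l'| + 1.
have C0 : 0 < C by rewrite ltr_wpDl.
have K0 : 0 < K by rewrite ltr_wpDl.
have eK0 : 0 < Num.min 1 (e / 2 / K) by rewrite lt_min ltr01 !divr_gt0.
have eC0 : 0 < e / 2 / C by rewrite !divr_gt0.
have [d1 d10 xd1] := dg _ eK0.
have [d2 d20 xd2] := df _ eC0.
exists (Num.min d1 (d2 / C)); first by rewrite lt_min d10 divr_gt0.
move=> y y01; rewrite lt_min ltr_pdivlMr// => /andP[yx1 yx2].
have := xd1 y y01 yx1; set r := g y - g x - _.
rewrite minr_pMl// le_min => /andP[r1 r2].
have gyx : g y - g x = l * (y - x) + r by rewrite /r; ring.
have gC : `|g y - g x| <= C * `|y - x|.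
  rewrite gyx (le_trans (ler_normD _ _))// normrM mulrDl lerD//.
have gd2 : `|g y - g x| < d2 by rewrite (le_lt_trans gC)// mulrC.
have := xd2 _ (g01 _ y01) gd2; set s := f (g y) - f (g x) - _ => sC.
rewrite [X in `|X|](_ : _ = s + l' * r); last by rewrite /s gyx /=; ring.
rewrite (le_trans (ler_normD _ _))// [e]splitr mulrDl lerD//.
  rewrite (le_trans sC)// -[leRHS](_ : e / 2 / C * (C * `|y - x|) = _).
    by rewrite ler_wpM2l// !divr_ge0// ltW.
  by rewrite mulrA divfK ?lt0r_neq0.
rewrite normrM (@le_trans _ _ (K * `|r|))//; first by rewrite ler_wpM2r// lerDl.
rewrite (le_trans (ler_wpM2l (ltW K0) r2))// mulrA [K * _]mulrC divfK//.
by rewrite lt0r_neq0.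
Qed.

Lemma le_derive01_0 f (k h : R) : derivable01 f 0 -> f 0 = 0 -> 0 < h ->
  (forall y, 0 <= y <= 1 -> y <= h -> k * y <= f y) -> k <= derive01 f 0.
Proof.
move=> df f0 h0 kf.
have z01 : (0 : R) \in `[0, 1] by rewrite in_itv /= lexx ler01.
apply/ler_addgt0Pr => e e0.
have [d d0 xd] := derivable01P z01 df e e0.
pose y := Num.min (Num.min 1 h) (d / 2).
have y0 : 0 < y by rewrite !lt_min ltr01 h0 divr_gt0.
have y1 : y <= 1 by rewrite !ge_min lexx.
have yh : y <= h by rewrite !ge_min lexx orbT.
have yd : y < d by rewrite gt_min; apply/orP; right; lra.
have := xd y; rewrite !subr0 f0 subr0 in_itv /= (ltW y0) y1 gtr0_norm//.
move=> /(_ isT yd)/ler_normlW fy; rewrite -(ler_pM2r y0).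
have := kf y; rewrite (ltW y0) y1 => /(_ isT yh); lra.
Qed.

End UnitIntervalDerivative.

(** * Orbits and derivatives of the pinched skew product *)

Section PinchedSkewProduct.
Set Implicit Arguments.
Unset Strict Implicit.
Context {R : realType} {D : nat}.
Variables (F : torus R D * R -> torus R D * R) (rho thetas : torus R D).
Hypothesis hF : in_classF_with F rho thetas.

Lemma fibre_iterP n theta x : x \in `[0, 1] ->
  iter n F (theta, x) = (theta + rho *+ n, fibre_iter F n theta x) /\
  fibre_iter F n theta x \in `[0, 1].
Proof.
move=> x01; elim: n => [|n [IH y01]]; first by rewrite mulr0n addr0.
rewrite [iter _ _ _]/= IH; split; last first.
  by rewrite /fibre_iter /fibre /= IH; exact: (maps_strip hF).
rewrite [LHS]surjective_pairing (skew_rotation hF)// mulrSr addrA.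
by rewrite /fibre_iter /fibre /= IH.
Qed.

Lemma fibre_iterS n theta x : x \in `[0, 1] ->
  fibre_iter F n.+1 theta x =
  fibre F (theta + rho *+ n) (fibre_iter F n theta x).
Proof. by move=> x01; rewrite {1}/fibre_iter /fibre /= (fibre_iterP n _ x01).1. Qed.

Lemma has_derive01_fibre_iter n theta x : x \in `[0, 1] ->
  has_derive01 (fibre_iter F n theta) x
    (\prod_(k < n) derive01 (fibre F (theta + rho *+ k)) (fibre_iter F k theta x)).
Proof.
move=> x01; elim: n => [|n IH]; first by rewrite big_ord0; exact: has_derive01_id.
rewrite big_ord_recr /= mulrC.
(* The recursion for the iterates is available on the strip only, as [F] is arbitrary outside it. *)
apply: (has_derive01_eq x01 (fun y => @fibre_iterS n theta y)).
have y01 := (fibre_iterP n theta x01).2.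
apply: has_derive01_comp => // [y /(fibre_iterP n theta)[]//|].
by apply: derivable01P => //; exact: (fibre_derivable hF).
Qed.

Lemma phi_plus_itv theta : phi_plus F theta \in `[0, 1].
Proof.
rewrite /phi_plus; set A := [set x | _].
have A1 : ubound A 1 by move=> x [] /=; rewrite in_itv /= => /andP[].
(* On an empty set [sup] takes the default value 0, which also lies in the interval. *)
have [/set0P A0|/negPn/eqP ->] := boolP (A != set0); last first.
  by rewrite sup0 in_itv /= lexx ler01.
have [x Ax] := A0; rewrite in_itv /= (ge_sup A0 A1) andbT.
rewrite (@le_trans _ _ x)//; last by apply: ub_le_sup => //; exists 1.
by have [] := Ax; rewrite in_itv /= => /andP[].
Qed.

Variables (alpha beta gamma L0 c d : R) (m : nat) (a b : R).
Hypothesis hFstar : Fstar_conditions F rho thetas alpha beta gamma L0 c d m a b.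

(* The pinched fibre over thetas is mapped to height 0 over thetas + rho, so
   condition (3) bounds the whole image of the strip near thetas + rho. *)
Lemma phi_plus_le theta :
  phi_plus F theta <= beta * torus_dist theta (thetas + rho).
Proof.
have bd0 : 0 <= beta * torus_dist theta (thetas + rho).
  by rewrite mulr_ge0 ?torus_dist_ge0// ltW// (Fstar_beta hFstar).
rewrite /phi_plus; set A := [set x | _].
have [/set0P A0|/negPn/eqP ->] := boolP (A != set0); last by rewrite sup0.
apply: ge_sup => // x [_ /(_ 1%N isT)] [[theta' y]] [_ /= y01] Fy.
have /= <- := congr1 fst Fy; have /= <- := congr1 snd Fy.
rewrite (skew_rotation hF)// torus_distDr.
have := Fstar3 hFstar theta' thetas y01; rewrite (pinched hF y01) subr0.
exact: le_trans (ler_norm _).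
Qed.

(** The zero section is invariant, so condition (1) against the point 0 bounds the growth of heights
    in each step. *)
Lemma fibre_iter_le n theta x : x \in `[0, 1] ->
  fibre_iter F n theta x <= alpha ^+ n * x.
Proof.
have a0 : 0 <= alpha by have := Fstar_alpha hFstar; lra.
have z01 : (0 : R) \in `[0, 1] by rewrite in_itv /= lexx ler01.
move=> x01; elim: n => [|n IH]; first by rewrite mul1r.
rewrite fibre_iterS// exprS -mulrA (le_trans _ (ler_wpM2l a0 IH))//.
have y01 := (fibre_iterP n theta x01).2.
have := Fstar1 hFstar (theta + rho *+ n) y01 z01.
rewrite (zero_invariant hF) !subr0 [X in _ <= _ * X]ger0_norm; last first.
  by move: y01; rewrite in_itv /= => /andP[].
exact: le_trans (ler_norm _).
Qed.

(** Up to height [2 * L0 / a] the first minimum in condition (9) is its linear branch [a * x], which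
    bounds the slope at 0. *)
Lemma fibre_derive0_ge theta :
  a * Num.min 1 (2 / b * torus_dist theta thetas) <= derive01 (fibre F theta) 0.
Proof.
have z01 : (0 : R) \in `[0, 1] by rewrite in_itv /= lexx ler01.
have a0 : 0 < a := lt_trans ltr01 (Fstar_a hFstar).
have /andP[L00 _] := Fstar_L0 hFstar.
apply: (@le_derive01_0 _ _ _ (2 * L0 / a)).
- exact: (fibre_derivable hF).
- exact: (zero_invariant hF).
- by rewrite divr_gt0// mulr_gt0.
- move=> y y01; rewrite ler_pdivlMr// mulrC => yL.
  have := Fstar9 hFstar theta (_ : y \in `[0, 1]); rewrite in_itv /= => /(_ y01).
  by rewrite (min_r yL) mulrAC.
Qed.

Let tau n := thetas + rho *+ n.

Let tauD i j : (i < j)%N ->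
  torus_dist (tau (j - i)) thetas = torus_dist (tau j) (tau i).
Proof.
move=> ij; rewrite -(torus_distDr (rho *+ i)) /tau -addrA -mulrnDr subnK//.
exact: ltnW.
Qed.

(* Two visits of the orbit to a small ball around thetas make rho *+ n small
   for the time n in between, which the Diophantine condition (4) forbids
   unless n is large. *)
Lemma tau_separated i j (t : R) : (i < j)%N -> 1 <= t ->
  torus_dist (tau i) thetas < b / 2 * t `^ (- d) ->
  torus_dist (tau j) thetas < b / 2 * t `^ (- d) -> t < (j - i)%:R.
Proof.
move=> ij t1 it jt; have /andP[b0 _] := Fstar_b hFstar.
have d0 : 0 < d := lt_trans ltr01 (Fstar_d hFstar).
have ji0 : 0 < (j - i)%:R :> R by rewrite ltr0n subn_gt0.
have t0 : 0 < t by exact: lt_le_trans t1.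
have n0 : (0 < j - i)%N by rewrite subn_gt0.
have := Fstar4 hFstar n0; rewrite -/(tau _) tauD// => cd.
have := torus_dist_triangle thetas (tau j) (tau i).
rewrite (torus_distC thetas) => /(le_trans cd) cd2.
have : b * (j - i)%:R `^ (- d) < b * t `^ (- d).
  rewrite (le_lt_trans (ler_wpM2r (powR_ge0 _ _) (Fstar7 hFstar)))//.
  rewrite (le_lt_trans cd2)//; lra.
rewrite ltr_pM2l// !powRN ltf_pV2 ?posrE ?powR_gt0//.
rewrite !ltNge; apply: contra => jit.
by apply: ge0_ler_powR => //; rewrite ?nnegrE; exact: ltW.
Qed.

Lemma prod_tau_dist_ge N : (2 `^ d) ^- (2 * N) <=
  \prod_(1 <= j < N.+1) Num.min 1 (2 / b * torus_dist (tau j) thetas).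
Proof.
have /andP[b0 _] := Fstar_b hFstar.
have d0 : 0 < d := lt_trans ltr01 (Fstar_d hFstar).
apply: prod_min1_dyadic => [|n].
  by rewrite -[leLHS](powRr0 (2 : R)); apply: ler_powR; [rewrite ler1n|exact: ltW].
have iE x : (2 / b * x < (2 `^ d) ^- n) = (x < b / 2 * (2 ^ n)%:R `^ (- d)).
  rewrite -[X in 2 / b * X < _]mulr1.
  rewrite -ltr_pdivlMl ?divr_gt0// invf_div mulr1 natrX powRN.
  by rewrite -[2 ^+ n]powR_mulrn// powRAC powR_mulrn// powR_ge0.
apply: (@count_separated
  (fun j => 2 / b * torus_dist (tau j) thetas < (2 `^ d) ^- n)).
  by rewrite expn_gt0.
move=> i j ij iP; rewrite iE => jt.
rewrite -(ler_nat R) ltW//; apply: tau_separated => //.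
  by rewrite ler1n expn_gt0.
(* The orbit starts at [thetas] itself, so time 0 is a visit at every level. *)
case/orP: iP => [/eqP ->|]; last by rewrite iE.
rewrite /tau mulr0n addr0 torus_distxx.
by rewrite mulr_gt0 ?divr_gt0 ?powR_gt0 ?ltr0n ?expn_gt0.
Qed.

Lemma expansion_beats_shrinking : 1 <= a / 4 * (2 `^ d) ^- 2.
Proof.
have d1 : 1 < d := Fstar_d hFstar.
have g0 : 0 < gamma := Fstar_gamma hFstar.
have m22 : (22 < m)%N.
  rewrite -(ltr_nat R) (le_lt_trans _ (Fstar5 hFstar))// ler_peMr//.
  by rewrite lerDl divr_ge0// ltW.
have p4 : 0 < (4 : R) `^ d by rewrite powR_gt0.
have q4 : (2 `^ d) ^+ 2 = 4 `^ d :> R.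
  by rewrite expr2 -powRM// -natrM.
have d6 : 4 <= (5 : R) `^ d.
  apply: (@le_trans _ _ (5 `^ 1)); first by rewrite powRr1// ler_nat.
  by apply: ler_powR; [rewrite ler1n|exact: ltW].
rewrite q4 -mulrA mulrCA -[leLHS](_ : 4^-1 * 4 = _); last by rewrite mulVf.
rewrite ler_pM2l ?invr_gt0// ler_pdivlMr// (le_trans _ (Fstar6 hFstar))//.
rewrite (le_trans (ler_wpM2r (ltW p4) d6))// -powRM// -natrM.
apply: ge0_ler_powR; rewrite ?nnegrE//; first by rewrite ltW// (lt_trans ltr01).
by rewrite ler_nat; lia.
Qed.

(** The first bound on [r] makes the orbit of [theta] shadow that of [thetas + rho] at half the
    Diophantine distance; the second keeps its heights below [h]. *)
Lemma one_le_derive01_fibre_iter (h r : R) N theta :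
  (forall x theta, x \in `[0, h] ->
     (1 - 2^-1) * derive01 (fibre F theta) 0 <= derive01 (fibre F theta) x) ->
  r <= c / 2 * N%:R `^ (- d) -> alpha ^+ N * (beta * r) <= h ->
  torus_dist theta (thetas + rho) <= r ->
  1 <= derive01 (fibre_iter F N theta) (phi_plus F theta).
Proof.
move=> hh rc rh thr; set x := phi_plus F theta.
have x01 : x \in `[0, 1] := phi_plus_itv theta.
have d0 : 0 < d := lt_trans ltr01 (Fstar_d hFstar).
have a0 : 0 < a := lt_trans ltr01 (Fstar_a hFstar).
have al1 : 1 <= alpha by have := Fstar_alpha hFstar; lra.
have be0 : 0 < beta := Fstar_beta hFstar.
have c0 : 0 < c := Fstar_c hFstar.
have /andP[b0 _] := Fstar_b hFstar.
have xr : x <= beta * r by rewrite (le_trans (phi_plus_le theta))// ler_wpM2l// ltW.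
have x0 : 0 <= x by move: x01; rewrite in_itv /= => /andP[].
rewrite (derive01_eq x01 (has_derive01_fibre_iter N theta x01)).
(* As [theta] is near [tau 1], time [k] is compared with [tau k.+1]. The shadowing error [r] is at
   most half the distance from [tau k.+1] to [thetas]. *)
have near k : (k < N)%N ->
    torus_dist (tau k.+1) thetas <= 2 * torus_dist (theta + rho *+ k) thetas.
  move=> kN.
  have := torus_dist_triangle (theta + rho *+ k) (tau k.+1) thetas.
  rewrite /tau (mulrS rho) addrA torus_distDr (torus_distC _ theta) => tri.
  have k0 : (0 < k.+1)%N by [].
  have := Fstar4 hFstar k0; rewrite -/(tau _) => ck.
  have : c / 2 * N%:R `^ (- d) <= c / 2 * k.+1%:R `^ (- d).
    rewrite ler_pM2l ?divr_gt0// !powRN.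
    rewrite lef_pV2 ?posrE ?powR_gt0 ?ltr0n//; last first.
      exact: leq_trans kN.
    by apply: ge0_ler_powR; rewrite ?nnegrE// ?ler_nat// ltW.
  move: ck; rewrite /tau (mulrS rho) addrA; lra.
(* Each step loses one factor 2 in [hh] and another in [near], which turns [a] into [a / 4]. *)
apply: (@le_trans _ _ ((a / 4) ^+ N * \prod_(1 <= j < N.+1)
    Num.min 1 (2 / b * torus_dist (tau j) thetas))).
  apply: (@le_trans _ _ ((a / 4) ^+ N * (2 `^ d) ^- (2 * N))).
    by rewrite exprM -exprVn -exprMn exprn_ege1// expansion_beats_shrinking.
  by rewrite ler_pM2l ?prod_tau_dist_ge// exprn_gt0// divr_gt0.
rewrite big_add1 big_mkord -{1}[N]card_ord -prodr_const -big_split/=.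
apply: ler_prod => k _; apply/andP; split.
  rewrite mulr_ge0 ?divr_ge0 ?(ltW a0)// le_min ler01.
  by rewrite mulr_ge0 ?torus_dist_ge0// divr_ge0// ltW.
have kN := ltn_ord k.
have xk : fibre_iter F k theta x \in `[0, h].
  have := (fibre_iterP k theta x01).2; rewrite !in_itv /= => /andP[-> _] /=.
  rewrite (le_trans (fibre_iter_le k theta x01))// (le_trans _ rh)//.
  apply: ler_pM => //; first by rewrite exprn_ge0// (le_trans ler01).
  by rewrite ler_weXn2l// ltnW.
rewrite (le_trans _ (hh _ _ xk))//.
have := fibre_derive0_ge (theta + rho *+ k).
set f := derive01 _ 0 => fge.
have mge : Num.min 1 (2 / b * torus_dist (tau k.+1) thetas) <=
    2 * Num.min 1 (2 / b * torus_dist (theta + rho *+ k) thetas).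
  rewrite minr_pMr// le_min !ge_min; apply/andP; split.
    by apply/orP; left; lra.
  by apply/orP; right; rewrite mulrCA ler_wpM2l ?divr_ge0 ?near// ltW.
have : a * Num.min 1 (2 / b * torus_dist (tau k.+1) thetas) <=
    a * (2 * Num.min 1 (2 / b * torus_dist (theta + rho *+ k) thetas)).
  by rewrite ler_pM2l.
move: fge; set u := Num.min _ _; set v := Num.min _ _ => fge uv.
rewrite (_ : a / 4 * v = a * v / 4); last by rewrite mulrAC.
have : a * (2 * u) = 2 * (a * u) by rewrite mulrCA.
lra.
Qed.

End PinchedSkewProduct.

(** * Lower bound for the measure of a ball in the torus *)

Section TorusBall.
Set Implicit Arguments.
Context {R : realType} {D : nat}.

Lemma torus_lebesgue_ball_ge (x : torus R D) (s : R) (A : set (torus R D)) :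
  0 <= s -> s <= 2^-1 ->
  (forall y, torus_dist y x <= D%:R * s -> A y) ->
  ((s ^+ D)%:E <= torus_lebesgue R D A)%E.
Proof.
move=> s0 s2 bA; have [u ux] := torus_proj_surj x.
pose w i := u ord0 i - (Num.floor (u ord0 i))%:~R.
have w01 i : 0 <= w i < 1.
  by have := Num.Theory.floor_itv (u ord0 i); rewrite /w subr_ge0 ltrBlDl intrD.
have wx : torus_proj (\row_i w i) = x.
  rewrite -ux; apply/torus_proj_eq; exists (fun i => - Num.floor (u ord0 i)) => i.
  by rewrite mxE mulrNz.
(* In each coordinate the cube extends from [w i] towards the farther face, so a side of at most one
   half stays in the unit cube. The value 0 beyond [D] only serves the bounds on all naturals. *)
pose l k := if insub k is Some i then if w i <= 2^-1 then w i else w i - s else 0.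
have lE (i : 'I_D) : l i = if w i <= 2^-1 then w i else w i - s.
  by rewrite /l valK.
rewrite -(@cube_measure_box R D l s)//; last 2 first.
- move=> k; rewrite /l; case: insubP => //= i _ _.
  by have /andP[wi0 _] := w01 i; case: (leP (w i)) => wi; lra.
- move=> k; rewrite /l; case: insubP => [i _ _|_]; last lra.
  by have /andP[_ wi1] := w01 i; case: (leP (w i)) => wi; lra.
rewrite /torus_lebesgue /distribution /pushforward; apply: le_cube_measure.
move=> t tl /=; apply: bA; rewrite -wx (le_trans (torus_dist_le _ _))//.
apply: ler_euclidean_norm_coord => // i; rewrite !mxE ler_norml.
have := tl i; rewrite lE; case: ifP => _ /andP[]; lra.
Qed.

End TorusBall.

(** * Choice of the exponential rate and conclusion *)

Theorem theorem4p4 (R : realType) (D : nat) (hD : (1 <= D)%N)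
    (F : torus R D * R -> torus R D * R) (hF : in_classFstar F)
    (hderiv : forall delta : R, 0 < delta ->
      exists xdelta : R, 0 < xdelta <= 1 /\
        forall (x : R) (theta : torus R D), x \in `[0, xdelta] ->
          (1 - delta) * derive01 (fibre F theta) 0
            <= derive01 (fibre F theta) x) :
  exists gamma_plus : R, 0 < gamma_plus /\
    forall N : nat, (1 <= N)%N ->
      ((expR (- gamma_plus * N%:R))%:E <=
        mu_phi_plus F
          [set p : torus R D * R | (p.2 \in `[0, 1])%R /\ (0 <= lyapunov F N p.1 p.2)%E])%E.
Proof.
have [rho [thetas [hFc [alpha [beta [gamma [L0 [c [d [m [a [b hFs]]]]]]]]]]]] := hF.
have half0 : (0 : R) < 2^-1 by rewrite invr_gt0.
have [h [/andP[h0 _] hh]] := hderiv _ half0.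
have al0 : 0 < alpha by have := Fstar_alpha hFs; lra.
have be0 : 0 < beta := Fstar_beta hFs.
have c0 : 0 < c := Fstar_c hFs.
have d0 : 0 < d := lt_trans ltr01 (Fstar_d hFs).
have D0 : 0 < D%:R :> R by rewrite ltr0n.
pose k1 := 2 + D%:R / (c / 2) + beta * D%:R / h.
have kc0 : 0 <= D%:R / (c / 2) by rewrite !divr_ge0// ltW.
have kb0 : 0 <= beta * D%:R / h by rewrite divr_ge0 ?mulr_ge0// ltW.
pose kappa := k1 + d + alpha.
have kappa0 : 0 < kappa by rewrite /kappa /k1; lra.
exists (D%:R * kappa); split; first exact: mulr_gt0.
(* [s] is the side of the cube, and [D%:R * s] the radius around [thetas + rho]. *)
move=> N N1; pose s := expR (- kappa * N%:R).
have N0 : 0 < N%:R :> R by rewrite ltr0n.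
have s0 : 0 < s := expR_gt0 _.
pose E1 := expR (- k1 * N%:R); pose E2 := expR (- d * N%:R).
pose E3 := expR (- alpha * N%:R).
have sE : s = E1 * E2 * E3.
  by rewrite /s /E1 /E2 /E3 -!expRD /kappa; congr expR; ring.
have exp_small (K k : R) : 0 <= K -> K <= k -> K * expR (- k * N%:R) <= 1.
  move=> K0 Kk; rewrite mulNr expRN ler_pdivrMr ?expR_gt0// mul1r.
  rewrite (le_trans _ (expR_ge1Dx _))// (le_trans Kk)//.
  have : k * 1 <= k * N%:R by rewrite ler_wpM2l ?(le_trans K0)// ler1n.
  lra.
have le1 (k : R) : 0 <= k -> expR (- k * N%:R) <= 1.
  by move=> k0; rewrite -expR0 ler_expR mulNr oppr_le0 mulr_ge0// ltW.
have E1_0 : 0 <= E1 := expR_ge0 _.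
have E2_0 : 0 <= E2 := expR_ge0 _.
have E3_0 : 0 <= E3 := expR_ge0 _.
have E2_1 : E2 <= 1 by apply: le1; exact: ltW.
have E3_1 : E3 <= 1 by apply: le1; exact: ltW.
(* This is [N <= expR N] raised to the power [- d]. *)
have E2N : E2 <= N%:R `^ (- d).
  rewrite /E2 mulrC expRM; rewrite !powRN lef_pV2 ?posrE ?powR_gt0 ?expR_gt0//.
  apply: ge0_ler_powR; rewrite ?nnegrE ?expR_ge0 ?ltW//.
  by rewrite (lt_le_trans _ (expR_ge1Dx _))// ltrDr.
have E3N : alpha ^+ N * E3 <= 1.
  rewrite /E3 mulNr expRN ler_pdivrMr ?expR_gt0// mul1r expRM_natr.
  rewrite lerXn2r ?nnegrE ?expR_ge0 ?ltW//.
  by rewrite (lt_le_trans _ (expR_ge1Dx _))// ltrDr.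
have s1 : 2 * s <= 1.
  have : 2 * E1 <= 1 by apply: exp_small => //; rewrite /k1; lra.
  move=> E12; rewrite sE -mulrA mulrA.
  by apply: mulr_ile1; rewrite ?mulr_ge0// mulr_ile1.
have sc : D%:R * s <= c / 2 * N%:R `^ (- d).
  have : D%:R / (c / 2) * E1 <= 1 by apply: exp_small => //; rewrite /k1; lra.
  rewrite mulrAC ler_pdivrMr ?divr_gt0// mul1r => E1c.
  rewrite sE -mulrA mulrA ler_pM ?mulr_ge0//.
  by rewrite -[leRHS]mulr1 ler_pM.
have sh : alpha ^+ N * (beta * (D%:R * s)) <= h.
  have : beta * D%:R / h * E1 <= 1 by apply: exp_small => //; rewrite /k1; lra.
  rewrite mulrAC ler_pdivrMr// mul1r => E1h.
  rewrite sE (_ : _ * _ = beta * D%:R * E1 * (E2 * (alpha ^+ N * E3)));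
    last by ring.
  have alE : 0 <= alpha ^+ N * E3 by rewrite mulr_ge0// exprn_ge0// ltW.
  have bDE : 0 <= beta * D%:R * E1 by rewrite !mulr_ge0// ltW.
  rewrite -[leRHS]mulr1 ler_pM//; first exact: mulr_ge0.
  exact: mulr_ile1.
rewrite (_ : - (D%:R * kappa) * N%:R = D%:R * (- kappa * N%:R)); last by ring.
rewrite expRM_natl.
apply: (@torus_lebesgue_ball_ge R D (thetas + rho) s); [exact: ltW|lra|].
move=> theta near; split=> /=; first exact: phi_plus_itv.
rewrite /lyapunov mule_ge0 ?lee_fin ?invr_ge0// lne_ge0 lee_fin.
exact: (one_le_derive01_fibre_iter hFc hFs hh sc sh near).
Qed.
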